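(* Let $(A,\sigma)$ be a real Hermitian algebra and $G=\mathrm{Sp}_2(A,\sigma)$. Let $F_{\mathfrak{C}_G,\mathfrak{P}_G^\pm}\colon\mathfrak{C}_G\to\mathfrak{P}_G^\pm$ be the map sending a complex structure $J$ to $l_J^\pm$, the $(\mp i)$-eigenline of $J_\mathbb{C}$ (that is, $J_\mathbb{C}(x)=\mp ix$ for all $x\in l_J^\pm$). Let $J\in\mathfrak{C}_G$, $L\in T_J\mathfrak{C}_G$, and let $x\in l_J^\pm$ be a generator of $l_J^\pm$. Then $$d_JF_{\mathfrak{C}_G,\mathfrak{P}_G^\pm}(L)=\left[x,\pm\tfrac{i}{2}L_\mathbb{C}(x)+l_J^\pm\right]=\pm\tfrac{i}{2}[L_\mathbb{C}]\in T_{l_J^\pm}\mathfrak{P}_G^\pm,$$ where $[L_\mathbb{C}]\colon l_J^\pm\to A_\mathbb{C}^2/l_J^\pm$ is the composition of $L_\mathbb{C}|_{l_J^\pm}\colon l_J^\pm\to A_\mathbb{C}^2$ with the natural projection.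
   Context: $A$ is a unital associative, possibly noncommutative, finite-dimensional semisimple $\mathbb{R}$-algebra and $\sigma\colon A\to A$ is an anti-involution: $\mathbb{R}$-linear, $\sigma(ab)=\sigma(b)\sigma(a)$, $\sigma^2=\mathrm{Id}$. For any involutive algebra $(B,\tau)$ put $B^\tau=\{a\in B\mid\tau(a)=a\}$, $B^\times$ the group of invertible elements, $\mathrm{O}(B,\tau)=\{a\in B^\times\mid \tau(a)=a^{-1}\}$, $B^\tau_+=\{a^2\mid a\in B^\tau\cap B^\times\}$, $B^\tau_-=-B^\tau_+$, $B^\tau_{\ge 0}=\{a^2\mid a\in B^\tau\}$. The pair $(A,\sigma)$ is Hermitian if for $x,y\in A^\sigma$, $x^2+y^2=0$ implies $x=y=0$; as standing properties of Hermitian algebras, $A^\sigma_+$ and $A^\sigma_{\ge0}$ are proper convex cones in $A^\sigma$, $\mathrm{O}(A,\sigma)$ is compact, and $x\mapsto ax\sigma(a)$ preserves $A^\sigma_+$ and $A^\sigma_{\geq 0}$ for every $a\in A^\times$. For $B=A$ or $B=A_\mathbb{C}:=A\otimes_\mathbb{R}\mathbb{C}$, $B^2$ is the right $B$-module of columns; $x\in B^2$ is regular if there is $y\in B^2$ such that $(a,b)\mapsto xa+yb$ is an isomorphism $B^2\to B^2$ of right $B$-modules; a $B$-line is $xB$ with $x$ regular. $\sigma_\mathbb{C}$ and $\bar\sigma_\mathbb{C}$ are the $\mathbb{C}$-linear and $\mathbb{C}$-antilinear extensions of $\sigma$ to $A_\mathbb{C}$. Let $\omega(x,y)=\sigma(x)^t\begin{pmatrix}0&1\\-1&0\end{pmatrix}y$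 on $A^2$ and $\omega_\mathbb{C}(x,y)=\sigma_\mathbb{C}(x)^t\begin{pmatrix}0&1\\-1&0\end{pmatrix}y$ on $A_\mathbb{C}^2$, and $h(x,y)=i\omega_\mathbb{C}(\bar x,y)$ on $A_\mathbb{C}^2$. $\mathrm{Sp}_2(A,\sigma)$ is the group of $A$-linear automorphisms of $A^2$ preserving $\omega$. A form $b\colon A^2\times A^2\to A$ that is biadditive with $b(xr_1,yr_2)=\sigma(r_1)b(x,y)r_2$ is a $\sigma$-inner product if $b(x,y)=\sigma(b(y,x))$ for all $x,y$, and for all regular $x$, $b(x,x)\in A^\sigma_{\geq0}$, with $b(x,x)=0$ if and only if $x=0$. $\mathfrak{C}_G$ is the set of $A$-linear $J\colon A^2\to A^2$ with $J^2=-\mathrm{Id}$ such that $h_J(x,y):=\omega(J(x),y)$ is a $\sigma$-inner product; it is a smooth manifold, homogeneous under conjugation by $G$, and tangent vectors are regarded as $A$-linear maps $L\colon A^2\to A^2$. $J_\mathbb{C},L_\mathbb{C}$ denote the $\mathbb{C}$-linear extensions to $A_\mathbb{C}^2$. $\mathfrak{P}_G^\pm=\{xA_\mathbb{C}\mid x\in A_\mathbb{C}^2\text{ regular},\ \omega_\mathbb{C}(x,x)=0,\ h(x,x)\in(A_\mathbb{C}^{\bar\sigma_\mathbb{C}})_\pm\}$, an open subset of the manifold of $\omega_\mathbb{C}$-isotropic $A_\mathbb{C}$-lines. Its tangent space at $l=xA_\mathbb{C}$ is $\{Q\in\mathrm{Hom}_{A_\mathbb{C}}(l,A_\mathbb{C}^2/l)\mid\omega_\mathbb{C}(Q(x),x)\in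 A_\mathbb{C}^{\sigma_\mathbb{C}}\}$; $[x,w]$ denotes the map $xa\mapsto wa$ (the velocity of $x(t)A_\mathbb{C}$ if $x(0)=x$, $\dot x(0)+l=w$). *)

(* Defs.v *)
From HB Require Import structures.
From mathcomp Require Import all_boot all_order all_algebra all_field.
From mathcomp Require Import complex.
From mathcomp Require Import all_classical all_reals all_analysis.

Set Implicit Arguments.
Unset Strict Implicit.
Unset Printing Implicit Defensive.

Import Order.TTheory GRing.Theory Num.Theory.
Import numFieldNormedType.Exports.

Local Open Scope classical_set_scope.
Local Open Scope ring_scope.
Local Open Scope complex_scope.

(** The tensor product of [A] with the complex numbers: the pair [(a, b)] is
    a (x) 1 + b (x) i. *)
Definition cplx (R : realType) (A : falgType R) : Type := (A * A)%type.

Section ComplexificationAlgebra.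
Variables (R : realType) (A : falgType R).
Local Notation AC := (cplx A).

HB.instance Definition _ := GRing.Zmodule.copy AC (A * A)%type.

Definition cplx_one : AC := (1, 0).
Definition cplx_mul (z w : AC) : AC :=
  (z.1 * w.1 - z.2 * w.2, z.1 * w.2 + z.2 * w.1).
Definition cplx_scale (c : R[i]) (z : AC) : AC :=
  (complex.Re c *: z.1 - complex.Im c *: z.2,
   complex.Re c *: z.2 + complex.Im c *: z.1).

Fact cplx_mulA : associative cplx_mul.
Proof.
move=> [a b] [c d] [e f]; rewrite /cplx_mul /=; congr pair;
  rewrite !(mulrDl, mulrDr, mulrN, mulNr, opprD, mulrA) -!addrA;
  (by congr (_ + _); rewrite addrA addrC).
Qed.
Fact cplx_mul1l : left_id cplx_one cplx_mul.
Proof. by move=> [a b]; rewrite /cplx_mul /= !mul1r !mul0r subr0 addr0. Qed.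
Fact cplx_mul1r : right_id cplx_one cplx_mul.
Proof. by move=> [a b]; rewrite /cplx_mul /= !mulr1 !mulr0 subr0 add0r. Qed.
Fact cplx_mulDl : left_distributive cplx_mul +%R.
Proof.
by move=> [a b] [c d] [e f]; rewrite /cplx_mul /= !mulrDl opprD; congr pair;
  rewrite addrACA.
Qed.
Fact cplx_mulDr : right_distributive cplx_mul +%R.
Proof.
by move=> [a b] [c d] [e f]; rewrite /cplx_mul /= !mulrDr opprD; congr pair;
  rewrite addrACA.
Qed.
Fact cplx_one_neq0 : cplx_one != 0.
Proof. by apply/eqP => -[/eqP]; rewrite oner_eq0. Qed.
HB.instance Definition _ := GRing.Zmodule_isNzRing.Build AC
  cplx_mulA cplx_mul1l cplx_mul1r cplx_mulDl cplx_mulDr cplx_one_neq0.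

Fact cplx_scaleA c d (z : AC) :
  cplx_scale c (cplx_scale d z) = cplx_scale (c * d) z.
Proof.
case: c d z => [x y] [x' y'] [a b]; rewrite /cplx_scale /=; congr pair;
  rewrite !(scalerDr, scalerDl, scalerN, scaleNr, opprD, scalerA) -!addrA;
  (by congr (_ + _); rewrite addrA addrC).
Qed.
Fact cplx_scale1 : left_id 1 cplx_scale.
Proof.
by move=> [a b]; rewrite /cplx_scale /= !scale1r !scale0r subr0 addr0.
Qed.
Fact cplx_scaleDr : right_distributive cplx_scale +%R.
Proof.
by move=> [x y] [a b] [c d]; rewrite /cplx_scale /= !scalerDr opprD;
  congr pair; rewrite addrACA.
Qed.
Fact cplx_scaleDl (z : AC) : {morph cplx_scale^~ z : c d / c + d}.
Proof.
by case: z => [a b] [x y] [x' y']; rewrite /cplx_scale /= !scalerDl opprD;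
  congr pair; rewrite addrACA.
Qed.
HB.instance Definition _ := GRing.Zmodule_isLmodule.Build R[i] AC
  cplx_scaleA cplx_scale1 cplx_scaleDr cplx_scaleDl.

Fact cplx_scaleAl (c : R[i]) (z w : AC) : c *: (z * w) = (c *: z) * w.
Proof.
case: c z w => [x y] [a b] [c d]; congr pair => /=;
  rewrite !(scalerDr, scalerN, mulrDl, mulNr, opprD, scalerAl) /= -!addrA;
  (by congr (_ + _); rewrite addrA addrC).
Qed.
HB.instance Definition _ := GRing.Lmodule_isLalgebra.Build R[i] AC cplx_scaleAl.

Fact cplx_scaleAr (c : R[i]) (z w : AC) : c *: (z * w) = z * (c *: w).
Proof.
case: c z w => [x y] [a b] [c d]; congr pair => /=;
  rewrite !(scalerDr, scalerN, mulrDr, mulrN, opprD, scalerAr) /= -!addrA;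
  (by congr (_ + _); rewrite addrCA).
Qed.
HB.instance Definition _ := GRing.Lalgebra_isAlgebra.Build R[i] AC cplx_scaleAr.

Definition cplx_inj (a : A) : AC := (a, 0).
Definition cplx_re (z : AC) : A := z.1.
Definition cplx_im (z : AC) : A := z.2.
Definition cplx_conj (z : AC) : AC := (z.1, - z.2).

End ComplexificationAlgebra.

Definition anti_involution (R : realType) (A : falgType R)
    (sigma : {linear A -> A}) : Prop :=
  (forall a b, sigma (a * b) = sigma b * sigma a) /\ involutive sigma.

(** Right ideals are subspaces; each one has a complementary right ideal. *)
Definition semisimple (R : realType) (A : falgType R) : Prop :=
  forall I : {vspace A}, (I * fullv <= I)%VS ->
  exists I' : {vspace A},
    [/\ (I' * fullv <= I')%VS, (I + I')%VS = fullv & (I :&: I')%VS = 0%VS].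

Section InvolutiveRing.
Variables (B : nzRingType) (tau : B -> B).

Definition symmetric_elts : set B := [set a | tau a = a].
Definition invertible_elts : set B :=
  [set a | exists b, a * b = 1 /\ b * a = 1].
Definition positive_elts : set B :=
  [set a ^+ 2 | a in symmetric_elts `&` invertible_elts].
Definition negative_elts : set B := [set (- a) | a in positive_elts].
Definition nonneg_elts : set B := [set a ^+ 2 | a in symmetric_elts].

Definition hermitian_pair : Prop :=
  forall x y, symmetric_elts x -> symmetric_elts y ->
    x ^+ 2 + y ^+ 2 = 0 -> x = 0 /\ y = 0.

(** The right action of a scalar [a] on a column [x] is [x *m a%:M]; the
    canonical [*:] on ['cV[B]_2] is the left one. *)
Definition rlinear (f : 'cV[B]_2 -> 'cV[B]_2) : Prop :=
  (forall x y, f (x + y) = f x + f y) /\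
  (forall x a, f (x *m a%:M) = f x *m a%:M).

Definition regular (x : 'cV[B]_2) : Prop :=
  exists y : 'cV[B]_2,
    bijective (fun ab : B * B => x *m ab.1%:M + y *m ab.2%:M).

Definition line (x : 'cV[B]_2) : set 'cV[B]_2 :=
  [set x *m a%:M | a in [set: B]].

Definition symplectic_mx : 'M[B]_2 := block_mx (0 : 'M[B]_1) 1%:M (- 1%:M) 0.

Definition omega (x y : 'cV[B]_2) : B :=
  ((map_mx tau x)^T *m symplectic_mx *m y) 0 0.

Definition sigma_inner_product (b : 'cV[B]_2 -> 'cV[B]_2 -> B) : Prop :=
  [/\ forall x x' y, b (x + x') y = b x y + b x' y,
      forall x y y', b x (y + y') = b x y + b x y',
      forall x y r1 r2, b (x *m r1%:M) (y *m r2%:M) = tau r1 * b x y * r2,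
      forall x y, b x y = tau (b y x) &
      forall x, regular x -> nonneg_elts (b x x) /\ (b x x = 0 <-> x = 0)].

Definition complex_structures : set ('cV[B]_2 -> 'cV[B]_2) :=
  [set J | [/\ rlinear J, forall x, J (J x) = - x &
               sigma_inner_product (fun x y => omega (J x) y)]].

(** The quotient of the columns by a submodule [l] is represented by the set
    of cosets of [l], and a map from [l] to this quotient by a total function,
    only the values of which on [l] matter. *)
Definition col_coset (l : set 'cV[B]_2) (w : 'cV[B]_2) : set 'cV[B]_2 :=
  [set w + u | u in l].

Definition coset_add (W W' : set 'cV[B]_2) : set 'cV[B]_2 :=
  [set w + w' | w in W & w' in W'].

Definition coset_rscale (l W : set 'cV[B]_2) (a : B) : set 'cV[B]_2 :=
  [set w *m a%:M + u | w in W & u in l].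

Definition quotient_hom (l : set 'cV[B]_2) (Q : 'cV[B]_2 -> set 'cV[B]_2)
    : Prop :=
  [/\ forall v, l v -> exists w, Q v = col_coset l w,
      forall v v', l v -> l v' -> Q (v + v') = coset_add (Q v) (Q v') &
      forall v a, l v -> Q (v *m a%:M) = coset_rscale l (Q v) a].

(** For [l = line x] with [x] regular and a coset [W], this is
    [x a |-> W a]; it is empty off [l]. *)
Definition bracket (l : set 'cV[B]_2) (x : 'cV[B]_2) (W : set 'cV[B]_2) :
    'cV[B]_2 -> set 'cV[B]_2 :=
  fun v => [set u | exists2 a, v = x *m a%:M & coset_rscale l W a u].

Definition quotient_map (l : set 'cV[B]_2) (L : 'cV[B]_2 -> 'cV[B]_2) :
    'cV[B]_2 -> set 'cV[B]_2 :=
  fun v => col_coset l (L v).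

End InvolutiveRing.

Section Curves.
Variable R : realType.

(** Coordinatewise in a basis, since [V] carries no canonical norm. *)
Definition derivative0 (V : vectType R) (g : R -> V) (v : V) : Prop :=
  forall i, is_derive (0 : R^o) (1 : R^o)
    (fun t => coord (vbasis (fullv : {vspace V})) i (g t) : R^o)
    (coord (vbasis (fullv : {vspace V})) i v).

Variable A : falgType R.

Definition derivative0_col (g : R -> 'cV[A]_2) (v : 'cV[A]_2) : Prop :=
  forall i, derivative0 (fun t => g t i 0) (v i 0).

Definition derivative0_ccol (z : R -> 'cV[cplx A]_2) (w : 'cV[cplx A]_2)
    : Prop :=
  derivative0_col (fun t => map_mx (@cplx_re R A) (z t))
                  (map_mx (@cplx_re R A) w) /\
  derivative0_col (fun t => map_mx (@cplx_im R A) (z t))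
                  (map_mx (@cplx_im R A) w).

Definition lifts (l : R -> set 'cV[cplx A]_2) (z : R -> 'cV[cplx A]_2)
    (w : 'cV[cplx A]_2) : Prop :=
  (\forall t \near (0 : R), regular (z t) /\ l t = line (z t)) /\
  derivative0_ccol z w.

(** The velocity [x(0), x'(0) + l] does not depend on the differentiable lift
    [x]; requiring this of every lift makes [Q] unique on [l 0]. *)
Definition line_velocity (l : R -> set 'cV[cplx A]_2)
    (Q : 'cV[cplx A]_2 -> set 'cV[cplx A]_2) : Prop :=
  (exists z w, lifts l z w) /\
  (forall z w, lifts l z w ->
     {in l 0, Q =1 bracket (l 0) (z 0) (col_coset (l 0) w)}).

End Curves.

Section Models.
Variables (R : realType) (A : falgType R) (sigma : {linear A -> A}).
Local Notation AC := (cplx A).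
Local Notation A2 := 'cV[A]_2.
Local Notation AC2 := 'cV[AC]_2.

Definition sigmaC (z : AC) : AC := (sigma z.1, sigma z.2).
Definition sigmaC_bar (z : AC) : AC := (sigma z.1, - sigma z.2).

Definition ccol_scale (c : R[i]) (z : AC2) : AC2 := map_mx ( *:%R c) z.

Definition col_conj (z : AC2) : AC2 := map_mx (@cplx_conj R A) z.

Definition complexify (f : A2 -> A2) (z : AC2) : AC2 :=
  map_mx (@cplx_inj R A) (f (map_mx (@cplx_re R A) z)) +
  ccol_scale 'i%C (map_mx (@cplx_inj R A) (f (map_mx (@cplx_im R A) z))).

Definition omegaC (x y : AC2) : AC := omega sigmaC x y.
Definition hform (x y : AC2) : AC := 'i%C *: omegaC (col_conj x) y.

(** The sign [+] is [false] and the sign [-] is [true]. *)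
Definition pm (s : bool) : R[i] := (-1) ^+ s.

Definition signed_elts (s : bool) : set AC :=
  if s then negative_elts sigmaC_bar else positive_elts sigmaC_bar.

Definition projective_model (s : bool) : set (set AC2) :=
  [set l | exists x, [/\ regular x, omegaC x x = 0,
                         signed_elts s (hform x x) & l = line x]].

Definition eigenline (s : bool) (J : A2 -> A2) : set AC2 :=
  [set z | complexify J z = ccol_scale (- (pm s * 'i%C)) z].

(** The space of right linear maps is finite-dimensional, so derivatives in it
    can be computed pointwise. *)
Definition curve_through (g : R -> A2 -> A2) (J L : A2 -> A2) : Prop :=
  [/\ \forall t \near (0 : R), complex_structures sigma (g t),
      g 0 = J &
      forall v, derivative0_col (fun t => g t v) (L v)].

Definition tangent_complex_structures (J : A2 -> A2) : set (A2 -> A2) :=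
  [set L | rlinear L /\ exists g, curve_through g J L].

Definition tangent_projective_model (s : bool) (l : set AC2) :
    set (AC2 -> set AC2) :=
  [set Q | [/\ projective_model s l, quotient_hom l Q &
      forall x w, l = line x -> Q x w -> symmetric_elts sigmaC (omegaC w x)]].

(** Kinematic differential: [F] sends every curve with velocity [L] at [J] to
    a curve with velocity [Q]. *)
Definition differential_at (F : (A2 -> A2) -> set AC2) (J L : A2 -> A2)
    (Q : AC2 -> set AC2) : Prop :=
  forall g, curve_through g J L -> line_velocity (fun t => F (g t)) Q.

Definition coset_cscale (l : set AC2) (c : R[i]) (W : set AC2) : set AC2 :=
  [set ccol_scale c w + u | w in W & u in l].

End Models.

(* Main.v *)
Require Import Defs.
From HB Require Import structures.
From mathcomp Require Import all_boot all_order all_algebra all_field.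
From mathcomp Require Import ring complex.
From mathcomp Require Import all_classical all_reals all_analysis.

Set Implicit Arguments.
Unset Strict Implicit.
Unset Printing Implicit Defensive.

Import Order.TTheory GRing.Theory Num.Theory.
Import numFieldNormedType.Exports.

Local Open Scope classical_set_scope.
Local Open Scope ring_scope.
Local Open Scope complex_scope.

(** If [J = [[a, b], [c, d]]] is in [complex_structures sigma], then [- c] is a
    square [q ^+ 2] with [q] symmetric, and positivity of the inner product on
    the columns [(y, 1)] forces [q] to be invertible.  Hence
    [z = e_0 + j J e_0], with [j = i] or [- i] the eigenscalar, is regular; it
    generates the eigenline of [J], which is isotropic because [J] is
    infinitesimally symplectic, and [h (z, z) = +- 2 q ^+ 2].

    For the differential, any lift [z t] of the eigenlines of a curve [g t]
    satisfies [g t (z t) = - j (z t)].  With [w = z' 0], this gives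
    [L (z 0) + J w = - j w], and since [L] anticommutes with [J], the vector
    [w - (j / 2) L (z 0)] satisfies the equation of the eigenline of [J]. *)

(** The powers of [a] with exponents below [n], one more than the dimension of [A], are linearly
    dependent: a nonzero vector in the kernel of [F] lists the coefficients of [p]. *)
Lemma annihilating_poly (K : fieldType) (A : falgType K) (a : A) :
  exists2 p : {poly K}, p != 0 & horner_alg a p = 0.
Proof.
set n := (\dim {:A}).+1.
pose f (v : 'rV[K]_n) : A := \sum_i v 0 i *: a ^+ i.
have f_lin : linear f.
  move=> k u v; rewrite /f scaler_sumr -big_split /=; apply: eq_bigr => i _.
  by rewrite !mxE scalerDl scalerA.
pose fL := GRing.isLinear.Build _ _ _ _ f f_lin.
pose F : {linear 'rV[K]_n -> A} := HB.pack f fL.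
have kerF : lker (linfun F) != 0%VS.
  apply/negP => /eqP ker0; have := limg_ker_dim (linfun F) fullv.
  rewrite capfv ker0 dimv0 add0n [RHS]dimvf => dimF.
  have dn : dim 'rV[K]_n = n by rewrite dim_matrix; exact: mul1n.
  rewrite dn in dimF.
  by have := dimvS (subvf (limg (linfun F))); rewrite dimF ltnn.
set v := vpick (lker (linfun F)).
have v_ker : v \in lker (linfun F) by rewrite memv_pick.
exists (rVpoly v).
  apply: contra kerF => /eqP p0.
  by rewrite -vpick0 -/v -(rVpolyK v) p0 linear0.
move: v_ker; rewrite memv_ker lfunE /= => /eqP <-.
rewrite /F /= /f /rVpoly poly_def linear_sum; apply: eq_bigr => i _ /=.
by rewrite linearZ /= rmorphXn /= horner_algX valK -scalerAl mul1r.
Qed.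

(** * Symmetric elements of a Hermitian algebra *)

Section SymmetricElements.
Variables (R : realType) (A : falgType R) (sigma : {linear A -> A}).
Hypotheses (sigma_anti : anti_involution sigma)
  (A_hermitian : hermitian_pair sigma).

Let sigmaM a b : sigma (a * b) = sigma b * sigma a.
Proof. by case: sigma_anti. Qed.
Let sigmaK a : sigma (sigma a) = a.
Proof. by case: sigma_anti => _; apply. Qed.

Lemma anti_involution1 : sigma 1 = 1.
Proof. by rewrite -[sigma 1]mulr1 -[X in _ * X]sigmaK -sigmaM mulr1 sigmaK. Qed.

Lemma anti_involution_horner q p :
  sigma q = q -> sigma (horner_alg q p) = horner_alg q p.
Proof.
move=> sq; elim/poly_ind: p => [|p c IH]; first by rewrite !raddf0.
rewrite [in RHS]mulrC !rmorphD !rmorphM /= !horner_algX !horner_algC.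
by rewrite linearD /= linearZ /= anti_involution1 sigmaM sq IH.
Qed.

(** The Hermitian condition with [y = 0] says that a symmetric element of square zero vanishes.
    Powers of [q] are symmetric, so an exponent that is a power of 2 can be halved until it is 1. *)
Lemma symmetric_nilpotent q n : sigma q = q -> q ^+ n = 0 -> q = 0.
Proof.
move=> sq qn; have q2n : q ^+ (2 ^ n) = 0.
  by rewrite -(subnK (ltnW (ltn_expl n (ltnSn 1)))) exprD qn mulr0.
elim: n {qn} q2n => [|n IH]; first by rewrite expn0 expr1.
rewrite expnSr exprM => q2n; apply: IH.
have sX : sigma (q ^+ (2 ^ n)) = q ^+ (2 ^ n).
  elim: (2 ^ n)%N => [|m IHm]; first by rewrite expr0 anti_involution1.
    by rewrite [in LHS]exprS sigmaM IHm sq -exprSr.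
have s0 : sigma 0 = 0 by rewrite raddf0.
by case: (A_hermitian sX s0) => //; rewrite q2n expr0n addr0.
Qed.

(** Without symmetric nilpotents, some annihilating polynomial of [q] has 0 as a simple root. Hence
    [A] splits into the kernel of [q] and a part where [q] is invertible: [e], a polynomial in [q],
    projects to the kernel, and [t] inverts [q] on the complement. *)
Lemma symmetric_annihilator q : sigma q = q ->
  exists e t, [/\ sigma e = e, e * e = e, q * e = 0, 1 - e = t * q
                & 1 - e = q * t].
Proof.
move=> sq; have [p p_neq0 pq0] := annihilating_poly q.
have [k [p' + def_p]] := multiplicity_XsubC p 0.
rewrite p_neq0 /= => p'0.
have qp'0 : horner_alg q (p' * 'X) = 0.
  apply: (@symmetric_nilpotent _ k.+1); first exact: anti_involution_horner.
  (* The exponent [k.+1] makes this power divisible by [p], also when [k = 0]. *)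
  have def_pX : (p' * 'X) ^+ k.+1 = p' ^+ k * 'X * p.
    by rewrite def_p subr0 exprMn exprSr exprS; ring.
  by rewrite -rmorphXn /= def_pX rmorphM /= pq0 mulr0.
(* The constant coefficient [c] is the value of [p'] at 0; dividing by it makes [1 - e] a multiple
   of [q]. *)
have [r [c def_p']] : exists r c, p' = r * 'X + c%:P.
  by elim/poly_ind: p' {p'0 def_p qp'0} => [|r c _]; [exists 0, 0;
    rewrite mul0r addr0 | exists r, c].
have c0 : c != 0 by apply: contra p'0;
  rewrite /root def_p' hornerMXaddC mulr0 add0r.
set e := c^-1 *: horner_alg q p'.
have qe : q * e = 0.
  by rewrite -scalerAr -[X in X * _](horner_algX q) -rmorphM /= mulrC qp'0
    scaler0.
have e1 : 1 - e = (- c^-1 *: horner_alg q r) * q.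
  rewrite /e def_p' rmorphD rmorphM /= horner_algX horner_algC scalerDr scalerA
    mulVf // scale1r.
  by rewrite addrC opprD addrNK scaleNr mulNr scalerAl.
have e2 : 1 - e = q * (- c^-1 *: horner_alg q r).
  rewrite e1 -scalerAl -scalerAr; congr (_ *: _).
  rewrite -[X in _ * X = _](horner_algX q).
  by rewrite -rmorphM mulrC rmorphM /= horner_algX.
exists e, (- c^-1 *: horner_alg q r); split=> //.
  by rewrite linearZ /= anti_involution_horner.
by apply/eqP; rewrite eq_sym -subr_eq0 -{1}[e]mul1r -mulrBl e1 -mulrA qe mulr0.
Qed.

End SymmetricElements.

(** * Invertibility from positivity *)

Section Invertibility.
Variables (R : realType) (A : falgType R) (sigma : {linear A -> A}).
Hypotheses (sigma_anti : anti_involution sigma)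
  (A_hermitian : hermitian_pair sigma).

(** If [p] annihilates [b] and [b * w = - (m ^+ 2 *: w)], then [p.[- m ^+ 2] *: w = 0]. The distinct
    numbers -1, -4, -9, ... cannot all be roots of [p]. *)
Lemma shift_injective (b : A) :
  exists2 m : R, m != 0 & forall w, b * w = - (m ^+ 2 *: w) -> w = 0.
Proof.
have [p p_neq0 pb] := annihilating_poly b.
pose m i : R := i.+1%:R.
have [i pi] : exists i, p.[- m i ^+ 2] != 0.
  apply: contrapT => /forallNP roots.
  pose rs := [seq - m i ^+ 2 | i <- iota 0 (size p)].
  have rsP : all (root p) rs.
    by apply/allP => _ /mapP[i _ ->]; apply/negPn/negP; exact: roots.
  have rs_uniq : uniq rs.
    rewrite map_inj_uniq ?iota_uniq // => i j /oppr_inj/eqP.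
    by rewrite eqrXn2 ?ler0n // eqr_nat eqSS => /eqP.
  by have := max_poly_roots p_neq0 rsP rs_uniq; rewrite size_map size_iota ltnn.
exists (m i); first by rewrite pnatr_eq0.
move=> w bw.
have pw (r : {poly R}) : horner_alg b r * w = r.[- m i ^+ 2] *: w.
  elim/poly_ind: r => [|r c IH]; first by rewrite raddf0 mul0r horner0 scale0r.
  rewrite rmorphD rmorphM /= horner_algX horner_algC mulrDl -mulrA bw -scaleNr.
  rewrite -scalerAr IH hornerMXaddC scalerDl scalerA mulrC; congr (_ + _).
  by rewrite -scalerAl mul1r.
have /eqP := pw p.
by rewrite pb mul0r eq_sym scaler_eq0 (negPf pi) => /eqP.
Qed.

(* The sums [sigma y * q ^+ 2 * y + ...] are the values of the inner product of
   a complex structure [[a, b], [- q ^+ 2, - sigma a]] on the columns [(y, 1)].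
   If [e] projects to the kernel of [q], a suitable [y] gives a value [r ^+ 2]
   that is block diagonal with scalar block [- m ^+ 2] on [e].  For [m] chosen
   such that [- m ^+ 2] is not an eigenvalue of the other block, [r] commutes
   with [e] and [(r e) ^+ 2 + (m e) ^+ 2 = 0]. *)
Lemma square_invertible (q a b : A) :
  sigma q = q -> sigma b = b ->
  a * a - b * q ^+ 2 = -1 -> q ^+ 2 * a = sigma a * q ^+ 2 ->
  (forall y, nonneg_elts sigma
     (sigma y * q ^+ 2 * y + sigma y * sigma a + a * y + b)) ->
  invertible_elts q.
Proof.
move=> sq sb aa qa pos; have [sM sK] := sigma_anti.
have [e [t [se ee qe e1 e2]]] := symmetric_annihilator sigma_anti A_hermitian
  sq.
suff e0 : e = 0 by exists t; rewrite -e1 -e2 e0 subr0.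
have q2e : q ^+ 2 * e = 0 by rewrite expr2 -mulrA qe mulr0.
have qt : q * t = t * q by rewrite -e1 -e2.
have e1e : (1 - e) * e = 0 by rewrite mulrBl ee mul1r subrr.
have ee1 : e * (1 - e) = 0 by rewrite mulrBr ee mulr1 subrr.
(* Here [1 - e = t * q] is idempotent and [t] commutes with [q], so
   [(1 - e) * z = t ^+ 2 * (q ^+ 2 * z)]. *)
have ker z : q ^+ 2 * z = 0 -> z = e * z.
  move=> qz; apply/eqP; rewrite -subr_eq0 -{1}[z]mul1r -mulrBl.
  have <- : (1 - e) * (1 - e) = 1 - e by rewrite mulrBr mulr1 e1e subr0.
  by rewrite e1 mulrA -[t * q * t]mulrA qt -!mulrA [q * (q * z)]mulrA qz !mulr0.
have eae : a * e = e * (a * e).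
  by apply: ker; rewrite mulrA qa -mulrA q2e mulr0.
have aae : a * (a * e) = - e.
  rewrite -[RHS]mulN1r -aa mulrBl -[b * _ * _]mulrA q2e mulr0 subr0.
  by rewrite mulrA.
pose b' := (1 - e) * b * (1 - e).
have [m m_neq0 b'_inj] := shift_injective b'.
(* For [y = - (a * e * k)] one has [q ^+ 2 * y = 0], and [a * y = e * k] because [a * a * e = - e].
   The value at [y] is therefore [b + e * k + sigma (e * k)], and [k] is chosen to make it
   [b' - m ^+ 2 *: e]. *)
pose k := 2^-1 *: (b * e) - b - (2^-1 * m ^+ 2) *: e.
have [r sr def_r] := pos (- (a * e * k)).
have rr : r ^+ 2 = b' - m ^+ 2 *: e.
  pose x := e * b * e; pose c := (2^-1 * m ^+ 2) *: e.
  have ek : e * k = 2^-1 *: x - e * b - c.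
    by rewrite /k !mulrBr -!(scalerAr _ e) ee mulrA.
  have ske : sigma (e * k) = 2^-1 *: x - b * e - c.
    by rewrite ek !(linearB, linearZ) /= !sM se sb mulrA.
  have half2 (v : A) : v = 2^-1 *: v + 2^-1 *: v.
    by rewrite -scalerDl -[2^-1]mul1r -splitr scale1r.
  have ay : a * (- (a * e * k)) = e * k.
    by rewrite mulrN !mulrA -[a * a * e]mulrA aae mulNr opprK.
  have qy : q ^+ 2 * (- (a * e * k)) = 0.
    by rewrite mulrN !mulrA qa -[_ * _ * e]mulrA q2e mulr0 mul0r oppr0.
  have def_b' : b' = (2^-1 *: x + 2^-1 *: x) + (b - e * b - b * e).
    by rewrite -half2 /b' mulrBl mul1r mulrBr mulr1 mulrBl opprB addrCA addrA.
  rewrite def_r -mulrA qy mulr0 add0r -sM ay ske ek def_b' (half2 (m ^+ 2 *: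
    e)).
  rewrite scalerA -/c.
  rewrite opprD; set y := 2^-1 *: x.
  by rewrite [LHS](AC (3*3*1) (1*4*(7*5*2)*(3*6)))/=.
have b'e : b' * e = 0 by rewrite /b' -mulrA e1e mulr0.
have eb' : e * b' = 0 by rewrite /b' !mulrA ee1 !mul0r.
have r2e : r ^+ 2 * e = - (m ^+ 2 *: e).
  by rewrite rr mulrBl b'e sub0r -scalerAl ee.
(* As [r] commutes with [r ^+ 2], left multiplication by [b'] scales [(1 - e) * r * e] by
   [- m ^+ 2]; the choice of [m] makes this element zero. *)
have re : r * e = e * (r * e).
  apply/eqP; rewrite -subr_eq0 -{1}[r * e]mul1r -mulrBl; apply/eqP/b'_inj.
  have b'1 : b' * (1 - e) = (1 - e) * r ^+ 2.
    by rewrite mulrBr b'e subr0 mulr1 rr mulrBl mul1r mulrBr eb' -scalerAr ee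
      sub0r opprK subrK.
  rewrite mulrA b'1 -mulrA [_ ^+ 2 * _]mulrA -exprSr exprS -mulrA r2e.
  by rewrite !mulrN -!scalerAr.
have er : e * r = r * e.
  by rewrite -{1}se -{1}sr -sM re !sM se sr mulrA.
have sre : sigma (r * e) = r * e by rewrite sM se sr er.
have sme : sigma (m *: e) = m *: e by rewrite linearZ /= se.
have [] := A_hermitian sre sme.
  rewrite exprZn !expr2 ee -mulrA [e * (r * e)]mulrA er -mulrA ee mulrA -expr2.
  by rewrite r2e addNr.
by move=> _ /eqP; rewrite scaler_eq0 (negPf m_neq0) => /eqP.
Qed.

End Invertibility.

(** * Derivatives of vector-valued curves *)

Section Derivatives.
Variable R : realType.
Implicit Types V W : vectType R.

Local Notation cd V i := (coord (vbasis (fullv : {vspace V})) i).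

Lemma derivative0_cst V (v : V) : derivative0 (fun=> v) 0.
Proof. by move=> i; rewrite linear0; exact: is_derive_cst. Qed.

Lemma derivative0_unique V (g : R -> V) v w :
  derivative0 g v -> derivative0 g w -> v = w.
Proof.
move=> gv gw; rewrite (coord_vbasis (memvf v)) (coord_vbasis (memvf w)).
apply: eq_bigr => i _; congr (_ *: _).
by rewrite -[LHS](@derive_val _ _ _ _ _ _ _ (gv i)) -[RHS](@derive_val _ _ _ _ _
  _ _ (gw i)).
Qed.

Lemma near_derivative0 V (f g : R -> V) v :
  {near (0 : R), f =1 g} -> derivative0 f v -> derivative0 g v.
Proof.
move=> fg fv i; have := fv i; apply: near_eq_is_derive.
by near do [congr (coord _ _ _)].
Unshelve. all: by end_near. Qed.

Lemma derivative0_linear V W (f : {linear V -> W}) g v :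
  derivative0 g v -> derivative0 (fun t => f (g t)) (f v).
Proof.
move=> gv i.
pose n := \dim (fullv : {vspace V}).
have fE u : cd W i (f u) =
    \sum_(j < n) cd W i (f (vbasis fullv)`_j) *: (cd V j u : R^o).
  rewrite [in LHS](coord_vbasis (memvf u)) linear_sum linear_sum /=.
  by apply: eq_bigr => j _; rewrite !linearZ /= mulrC.
rewrite fE [X in is_derive _ _ X](_ : _ = \sum_(j < n)
  (cd W i (f (vbasis fullv)`_j) *: (fun t => cd V j (g t) : R^o))).
  by apply: is_derive_sum => j; apply: is_deriveZ; exact: gv.
by apply/funext => t; rewrite fE fct_sumE.
Qed.

Lemma derivative0D V (f g : R -> V) v w :
  derivative0 f v -> derivative0 g w -> derivative0 (fun t =>
    f t + g t) (v + w).
Proof.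
move=> fv gw i; rewrite linearD [X in is_derive _ _ X](_ : _ =
  (fun t => cd V i (f t) : R^o) + (fun t => cd V i (g t) : R^o)).
  by apply: is_deriveD; [exact: fv | exact: gw].
by apply/funext => t; rewrite linearD.
Qed.

Lemma derivative0_sum V n (f : 'I_n -> R -> V) (v : 'I_n -> V) :
  (forall i, derivative0 (f i) (v i)) ->
  derivative0 (fun t => \sum_i f i t) (\sum_i v i).
Proof.
move=> fv i; rewrite linear_sum [X in is_derive _ _ X](_ : _ =
  \sum_j (fun t => cd V i (f j t) : R^o)).
  by apply: is_derive_sum => j; exact: fv.
by apply/funext => t; rewrite linear_sum fct_sumE.
Qed.

Variable A : falgType R.

(** Expanding the left factor in a basis writes [u * v] as a sum of scalar coordinates of [u] times
    the linear images [e j * v]. The scalar product rule applies to each term, and the order of the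
    factors is kept. *)
Lemma derivative0M (f g : R -> A) a b :
  derivative0 f a -> derivative0 g b ->
  derivative0 (fun t => f t * g t) (a * g 0 + f 0 * b).
Proof.
move=> fa gb i; pose e j : A := (vbasis fullv)`_j.
have mulE u v : u * v = \sum_j cd A j u *: (e j * v).
  rewrite {1}(coord_vbasis (memvf u)) mulr_suml.
  by apply: eq_bigr => j _; rewrite -scalerAl.
rewrite linearD (mulE a) (mulE (f 0)) !linear_sum -big_split /=.
rewrite [X in is_derive _ _ X](_ : _ = \sum_j
  ((fun t => cd A j (f t) : R^o) * (fun t => cd A i (e j * g t) : R^o))).
  apply: is_derive_sum => j.
  have ejb := derivative0_linear (e j \*o @idfun A) gb.
  apply: (is_derive_eq (is_deriveM (fa j) (ejb i))); rewrite !linearZ /= addrC.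
  by congr (_ + _); rewrite mulrC.
apply/funext => t; rewrite mulE linear_sum fct_sumE.
by apply: eq_bigr => j _; rewrite linearZ.
Qed.

(** Stated for all shapes, so that one product rule covers products of operator matrices and their
    action on columns. *)
Definition derivative0_mx m n (G : R -> 'M[A]_(m, n)) (D : 'M[A]_(m, n)) :=
  forall i j, derivative0 (fun t => G t i j) (D i j).

Lemma derivative0_mx_cst m n (M : 'M[A]_(m, n)) : derivative0_mx (fun=> M) 0.
Proof. by move=> i j; rewrite mxE; exact: derivative0_cst. Qed.

Lemma derivative0_mx_unique m n (G : R -> 'M[A]_(m, n)) D E :
  derivative0_mx G D -> derivative0_mx G E -> D = E.
Proof.
move=> GD GE; apply/matrixP => i j.
exact: derivative0_unique (GD i j) (GE i j).
Qed.

Lemma near_derivative0_mx m n (F G : R -> 'M[A]_(m, n)) D :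
  {near (0 : R), F =1 G} -> derivative0_mx F D -> derivative0_mx G D.
Proof.
move=> FG FD i j; apply: near_derivative0 (FD i j).
by apply: filterS FG => t /= ->.
Qed.

Lemma derivative0_mxD m n (F G : R -> 'M[A]_(m, n)) D E :
  derivative0_mx F D -> derivative0_mx G E ->
  derivative0_mx (fun t => F t + G t) (D + E).
Proof.
move=> FD GE i j; rewrite mxE; under eq_fun do rewrite mxE.
exact: derivative0D.
Qed.

Lemma derivative0_mxM m n p (F : R -> 'M[A]_(m, n)) (G : R ->
  'M[A]_(n, p)) D E :
  derivative0_mx F D -> derivative0_mx G E ->
  derivative0_mx (fun t => F t *m G t) (D *m G 0 + F 0 *m E).
Proof.
move=> FD GE i j; rewrite !mxE -big_split /=; under eq_fun do rewrite mxE.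
by apply: derivative0_sum => k; exact: derivative0M.
Qed.

End Derivatives.

(** * Right modules of columns *)

Section Columns.
Variable B : nzRingType.
Implicit Types (x y z : 'cV[B]_2) (M : 'M[B]_2).

Lemma ord2P (P : 'I_2 -> Prop) : P 0 -> P 1 -> forall i, P i.
Proof.
move=> P0 P1 [[|[|//]] lti]; first by rewrite (_ : Ordinal lti = 0) //;
  exact: val_inj.
by rewrite (_ : Ordinal lti = 1) //; exact: val_inj.
Qed.

Lemma col2P x y : x 0 0 = y 0 0 -> x 1 0 = y 1 0 -> x = y.
Proof. by move=> xy0 xy1; apply/matrixP => i j; rewrite ord1;
  elim/ord2P: i. Qed.

Lemma mulmx2E m n (C : 'M[B]_(m, 2)) (D : 'M[B]_(2, n)) i j :
  (C *m D) i j = C i 0 * D 0 j + C i 1 * D 1 j.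
Proof. by rewrite mxE big_ord_recl big_ord1; congr (_ + C i _ * D _ j);
  exact: val_inj. Qed.

Lemma mul_col_scalarE x a i : (x *m a%:M) i 0 = x i 0 * a.
Proof. by rewrite mxE big_ord1 mxE eqxx mulr1n. Qed.

Lemma addcolE x y i : (x + y) i 0 = x i 0 + y i 0.
Proof. by rewrite mxE. Qed.

Lemma mulmx_col_inj (M N : 'M[B]_2) : (forall x, M *m x = N *m x) -> M = N.
Proof.
move=> MN; apply/matrixP => i j.
by have /matrixP/(_ i 0) := MN (delta_mx j 0); rewrite -!colE !mxE.
Qed.

(** Scalars act on the right, so right linear maps are left multiplications by matrices, and
    composition is the matrix product even over a noncommutative [B]. *)
Definition rlinear_mx (f : 'cV[B]_2 -> 'cV[B]_2) : 'M[B]_2 :=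
  \matrix_(i, j) f (delta_mx j 0) i 0.

Lemma rlinear_mxE f x : rlinear f -> f x = rlinear_mx f *m x.
Proof.
case=> fD fM; have -> : x = delta_mx 0 0 *m (x 0 0)%:M + delta_mx 1 0 *m (x 1
  0)%:M.
  by apply: col2P; rewrite mxE !mul_col_scalarE !mxE /= !(mul1r, mul0r, addr0,
    add0r).
have fe j : f (delta_mx j 0) = rlinear_mx f *m delta_mx j 0.
  by apply/matrixP => i k; rewrite -colE !mxE ord1.
by rewrite fD !fM mulmxDr !mulmxA !fe.
Qed.

Lemma invertible_eltsM (a b : B) :
  invertible_elts a -> invertible_elts b -> invertible_elts (a * b).
Proof.
move=> [a' [aa' a'a]] [b' [bb' b'b]]; exists (b' * a'); split.
  by rewrite mulrA -(mulrA a) bb' mulr1.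
by rewrite mulrA -(mulrA b') a'a mulr1.
Qed.

Lemma invertible_eltsN (a : B) : invertible_elts a -> invertible_elts (- a).
Proof. by move=> [a' [aa' a'a]]; exists (- a'); rewrite !mulrNN. Qed.

(** Together with the first basis column, [x] forms a basis: the second coordinate of a column
    determines the coefficient of [x], and the first coordinate then gives the other coefficient. *)
Lemma regular_invertible x : invertible_elts (x 1 0) -> regular x.
Proof.
move=> [u [xu ux]]; exists (delta_mx 0 0).
exists (fun v : 'cV[B]_2 => (u * v 1 0, v 0 0 - x 0 0 * (u * v 1 0))) =>
  [[a b]|v] /=.
  rewrite !addcolE !mul_col_scalarE !mxE /= mul0r mul1r addr0 mulrA ux mul1r.
  by rewrite addrC addKr.
apply: col2P; rewrite !addcolE !mul_col_scalarE !mxE /= ?mul1r ?mul0r ?addr0.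
  by rewrite addrC subrK.
by rewrite mulrA xu mul1r.
Qed.

Lemma regular_delta0 : regular (delta_mx 0 0 : 'cV[B]_2).
Proof.
exists (delta_mx 1 0); exists (fun v : 'cV[B]_2 => (v 0 0, v 1 0)) =>
  [[a b]|v] /=.
  by rewrite !addcolE !mul_col_scalarE !mxE /= !(mul1r, mul0r, addr0, add0r).
by apply: col2P; rewrite !addcolE !mul_col_scalarE !mxE /= !(mul1r, mul0r,
  addr0, add0r).
Qed.

Definition rsubmodule (l : set 'cV[B]_2) : Prop :=
  [/\ l 0, forall x y, l x -> l y -> l (x - y) & forall x a, l x ->
    l (x *m a%:M)].

Lemma rsubmoduleD l x y : rsubmodule l -> l x -> l y -> l (x + y).
Proof.
move=> [l0 lB _] lx ly; rewrite -[y]opprK; apply: (lB) => //.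
by rewrite -sub0r; exact: lB.
Qed.

Lemma eq_col_coset l x y : rsubmodule l -> l (x - y) ->
  col_coset l x = col_coset l y.
Proof.
move=> lP lxy; have [l0 lB _] := lP.
have sub x' y' : l (x' - y') -> col_coset l x' `<=` col_coset l y'.
  move=> lxy' _ [u lu <-]; exists (x' - y' + u); first exact: rsubmoduleD.
  by rewrite addrA [y' + _]addrC subrK.
by apply/seteqP; split; apply: sub => //; rewrite -opprB -sub0r; exact: lB.
Qed.

(** Right linearity frees the bracket from its generator: once its value at [x] is the coset of
    [M *m x], it is [v |-> M *m v + l]. Brackets taken at different generators are compared in this
    form. *)
Lemma bracket_quotient_map l x w M v : rsubmodule l ->
    col_coset l w = col_coset l (M *m x) -> line x v ->
  bracket l x (col_coset l w) v = quotient_map l (mulmx M) v.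
Proof.
move=> lP -> [a _ <-]; have [l0 _ lM] := lP; apply/seteqP; split=> u.
  move=> [b ->] [_ [u' lu' <-]] [u'' lu'' <-]; exists (u' *m b%:M + u'').
    by apply: rsubmoduleD => //; exact: lM.
  by rewrite mulmxDl mulmxA addrA.
move=> [u' lu' <-]; exists a => //; exists (M *m x); last by exists u';
  rewrite ?mulmxA.
by exists 0; rewrite ?addr0.
Qed.

Lemma quotient_map_hom l M : rsubmodule l ->
  quotient_hom l (quotient_map l (mulmx M)).
Proof.
move=> lP; have [l0 _ lM] := lP; split=> [v _|v v' _ _|v a _];
  first by exists (M *m v).
  apply/seteqP; split=> [_ [u lu <-]|_ [_ [u lu <-]] [_ [u' lu' <-] <-]].
    exists (M *m v); first by exists 0; rewrite ?addr0.
    by exists (M *m v' + u); [exists u | rewrite mulmxDr addrA].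
  by exists (u + u'); [exact: rsubmoduleD | rewrite mulmxDr addrACA].
apply/seteqP; split=> [_ [u lu <-]|_ [_ [u lu <-]] [u' lu' <-]].
  by exists (M *m v); [exists 0; rewrite ?addr0 | exists u; rewrite ?mulmxA].
exists (u *m a%:M + u'); first by apply: rsubmoduleD => //; exact: lM.
by rewrite mulmxDl mulmxA addrA.
Qed.

End Columns.

(** * The symplectic form and its infinitesimal symmetries *)

Section Omega.
Variables (B : nzRingType) (tau : {additive B -> B}).
Hypothesis tauM : forall a b, tau (a * b) = tau b * tau a.
Implicit Types (x y z : 'cV[B]_2) (M : 'M[B]_2).

Lemma omegaE x y : omega tau x y = tau (x 0 0) * y 1 0 - tau (x 1 0) * y 0 0.
Proof.
have S i j : symplectic_mx B i j = ((i == 0) && (j == 1))%:R - ((i == 1) && (j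
  == 0))%:R.
  elim/ord2P: i; elim/ord2P: j; rewrite /symplectic_mx mxE;
    (case: splitP => k; rewrite (ord1 k) // => _); rewrite mxE;
    (case: splitP => k'; rewrite (ord1 k') // => _);
    by rewrite !mxE ?subrr ?subr0 ?sub0r.
rewrite /omega mulmx2E !(mulmx2E _ (symplectic_mx B)) !S !mxE /=.
by rewrite !(subr0, sub0r, mulr0, mulr1, mulrN, addr0, add0r, mulNr) addrC.
Qed.

Lemma omegaDl x x' y : omega tau (x + x') y = omega tau x y + omega tau x' y.
Proof. by rewrite !omegaE !mxE !raddfD !mulrDl opprD addrACA. Qed.

Lemma omegaDr x y y' : omega tau x (y + y') = omega tau x y + omega tau x y'.
Proof. by rewrite !omegaE !mxE !mulrDr opprD addrACA. Qed.

Lemma omegaNl x y : omega tau (- x) y = - omega tau x y.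
Proof. by rewrite !omegaE !mxE !raddfN !mulNr opprD. Qed.

Lemma omegaNr x y : omega tau x (- y) = - omega tau x y.
Proof. by rewrite !omegaE !mxE !mulrN opprD. Qed.

(** For an involutive [tau], these are the matrices of the symplectic Lie algebra. The conditions on
    the entries are additive, so they pass directly to derivatives and to the complexification. *)
Definition infinitesimal_symplectic M : Prop :=
  [/\ M 1 1 = - tau (M 0 0), tau (M 1 0) = M 1 0 & tau (M 0 1) = M 0 1].

Lemma omega_infinitesimal M x y : involutive tau ->
  infinitesimal_symplectic M ->
  omega tau (M *m x) y = - omega tau x (M *m y).
Proof.
move=> tauK [M11 M10 M01]; rewrite !omegaE !mulmx2E M11 !raddfD !tauM M10 M01
  raddfN tauK /=.
rewrite !(mulrDl, mulrDr, mulNr, mulrN, opprD, opprK, mulrA).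
by rewrite [LHS](AC (2*2) ((3*1)*(4*2))).
Qed.

End Omega.

(** * Complex structures *)

Section ComplexStructures.
Variables (R : realType) (A : falgType R) (sigma : {linear A -> A}).
Hypotheses (sigma_anti : anti_involution sigma)
  (A_hermitian : hermitian_pair sigma).

Let sigmaM a b : sigma (a * b) = sigma b * sigma a.
Proof. by case: sigma_anti. Qed.
Let sigmaK : involutive sigma.
Proof. by case: sigma_anti. Qed.

Lemma complex_structure_sqr J : complex_structures sigma J ->
  rlinear_mx J *m rlinear_mx J = -1%:M.
Proof.
move=> [Jlin JJ _]; apply: mulmx_col_inj => x.
by rewrite -mulmxA -!(rlinear_mxE _ Jlin) JJ mulNmx mul1mx.
Qed.

(** Symmetry of the inner product says [omega (J x, y) = - omega (x, J y)]; on pairs of basis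
    columns it becomes the relations between the entries. *)
Lemma complex_structure_infinitesimal J : complex_structures sigma J ->
  infinitesimal_symplectic sigma (rlinear_mx J).
Proof.
move=> [Jlin JJ [_ _ _ sym _]].
move: (rlinear_mx J) (fun x => rlinear_mxE x Jlin) => M JE.
have symE i j : omega sigma (col i M) (delta_mx j 0) =
    sigma (omega sigma (col j M) (delta_mx i 0)).
  by move: (sym (delta_mx i 0) (delta_mx j 0)); rewrite !JE -!colE.
have := symE 1 0; have := symE 0 0; have := symE 1 1; rewrite !omegaE !mxE /=.
rewrite !(mulr0, mulr1, subr0, sub0r) raddfN /= !sigmaK =>
  M01 /oppr_inj M10 M11.
by split=> //; rewrite -M11 raddfN /= sigmaK opprK.
Qed.

(** The value of the inner product at the first basis column is [- M 1 0], whence [q]. Two entries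
    of [M *m M = -1%:M] and the values at the columns [(y, 1)] supply the hypotheses of
    [square_invertible]. *)
Lemma complex_structure_invertible J : complex_structures sigma J ->
  exists q, [/\ sigma q = q, invertible_elts q & rlinear_mx J 1 0 = - q ^+ 2].
Proof.
move=> JC; have [Jlin JJ [_ _ _ sym pos]] := JC.
move: (complex_structure_infinitesimal JC) (complex_structure_sqr JC).
move: (rlinear_mx J) (fun x => rlinear_mxE x Jlin) => M JE [M11 M10 M01] MM.
have [[q sq def_q] _] := pos _ (regular_delta0 A).
rewrite JE -colE omegaE !mxE /= mulr0 mulr1 sub0r M10 in def_q.
exists q; split=> //; last by rewrite def_q opprK.
have M10q : M 1 0 = - q ^+ 2 by rewrite def_q opprK.
have /matrixP MMe := MM.
apply: (square_invertible sigma_anti A_hermitian (a := M 0 0) (b :=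
  M 0 1)) => //.
- by have := MMe 0 0; rewrite mulmx2E M10q !mxE mulrN.
- have := MMe 1 0; rewrite mulmx2E M11 M10q !mxE oppr0 mulrNN mulNr => /eqP.
  by rewrite addrC subr_eq0 => /eqP.
(* Positivity is available on regular columns only; the entry 1 makes this column regular for every
   [y]. *)
move=> y; pose x : 'cV[A]_2 := \col_i (if i == 0 then y else 1).
have x_reg : regular x.
  by apply: regular_invertible; rewrite mxE /=; exists 1; rewrite mulr1.
have [+ _] := pos x x_reg; congr (nonneg_elts _ _).
rewrite JE omegaE !mulmx2E !mxE /= M11 M10q !raddfD /= !sigmaM !raddfN /=
  sigmaK.
have sq2 : sigma (q ^+ 2) = q ^+ 2 by rewrite expr2 sigmaM sq.
rewrite sq2 (anti_involution1 sigma_anti) !mul1r mulr1 M01.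
rewrite !(mulrN, mulNr, mulrDl, opprD, opprK).
by rewrite [LHS](AC (2*2) (3*1*4*2)).
Qed.

End ComplexStructures.

(** * Complexification *)

Section Complexification.
Variables (R : realType) (A : falgType R) (sigma : {linear A -> A}).
Hypothesis sigma_anti : anti_involution sigma.
Local Notation AC := (cplx A).
Local Notation inj := (@cplx_inj R A).
Implicit Types (M N : 'M[A]_2) (z w : 'cV[AC]_2) (c d : R[i]).

Fact cplx_inj_zmod_morphism : zmod_morphism inj.
Proof. by move=> a b; congr pair; rewrite subr0. Qed.
HB.instance Definition _ :=
  GRing.isZmodMorphism.Build A AC inj cplx_inj_zmod_morphism.
Fact cplx_inj_monoid_morphism : monoid_morphism inj.
Proof. by split=> // a b; congr pair => /=;
  rewrite ?mulr0 ?mul0r ?subr0 ?addr0. Qed.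
HB.instance Definition _ :=
  GRing.isMonoidMorphism.Build A AC inj cplx_inj_monoid_morphism.

Fact sigmaC_zmod_morphism : zmod_morphism (sigmaC sigma).
Proof. by move=> x y; congr pair; rewrite linearB. Qed.
HB.instance Definition _ :=
  GRing.isZmodMorphism.Build AC AC (sigmaC sigma) sigmaC_zmod_morphism.

Lemma sigmaCM (x y : AC) : sigmaC sigma (x * y) = sigmaC sigma y * sigmaC sigma
  x.
Proof.
have [sM _] := sigma_anti.
by congr pair; rewrite ?linearB ?linearD /= !sM // addrC.
Qed.

Lemma sigmaCK : involutive (sigmaC sigma).
Proof. by have [_ sK] := sigma_anti; move=> [a b]; rewrite /sigmaC /= !sK. Qed.

Lemma sigmaCZ c (x : AC) : sigmaC sigma (c *: x) = c *: sigmaC sigma x.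
Proof. by congr pair; rewrite /= !(linearB, linearD, linearZ). Qed.

Lemma sigmaC_inj a : sigmaC sigma (inj a) = inj (sigma a).
Proof. by rewrite /sigmaC /cplx_inj /= linear0. Qed.

Lemma sigmaC_alg c : sigmaC sigma c%:A = c%:A.
Proof. by rewrite sigmaCZ (sigmaC_inj 1) (anti_involution1 sigma_anti). Qed.

Lemma alg_comm c (x : AC) : x * c%:A = c%:A * x.
Proof. by rewrite -scalerAr -scalerAl mulr1 mul1r. Qed.

Lemma alg_scalemxAr c m n p (C : 'M[AC]_(m, n)) (D : 'M[AC]_(n, p)) :
  C *m (c%:A *: D) = c%:A *: (C *m D).
Proof.
apply/matrixP => i j; rewrite !mxE mulr_sumr; apply: eq_bigr => k _.
by rewrite mxE !mulrA alg_comm.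
Qed.

(** A complex scalar acts through the central element [c%:A], which gives access to the scaling of
    matrices over [AC]. *)
Lemma ccol_scaleE c z : ccol_scale c z = c%:A *: z.
Proof. by apply/matrixP => i j; rewrite !mxE -scalerAl mul1r. Qed.

Lemma scale_algA m n c d (C : 'M[AC]_(m, n)) : c%:A *: (d%:A *: C) = (c * d)%:A
  *: C.
Proof. by rewrite scalerA -scalerAl mul1r scalerA. Qed.

Lemma omegaC_Zl c z w : omegaC sigma (c%:A *: z) w = c%:A * omegaC sigma z w.
Proof.
rewrite /omegaC !omegaE /= !mxE !sigmaCM sigmaC_alg mulrBr.
by rewrite !alg_comm !mulrA.
Qed.

Lemma omegaC_Zr c z w : omegaC sigma z (c%:A *: w) = c%:A * omegaC sigma z w.
Proof. by rewrite /omegaC !omegaE !mxE mulrBr !mulrA !alg_comm. Qed.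

Lemma infinitesimal_symplectic_cplx M : infinitesimal_symplectic sigma M ->
  infinitesimal_symplectic (sigmaC sigma) (map_mx inj M).
Proof.
move=> [M11 M10 M01]; split; rewrite /= !mxE sigmaC_inj ?M10 ?M01 //.
by rewrite M11 rmorphN.
Qed.

Lemma omegaC_infinitesimal M z w : infinitesimal_symplectic sigma M ->
  omegaC sigma (map_mx inj M *m z) w = - omegaC sigma z (map_mx inj M *m w).
Proof.
move=> /infinitesimal_symplectic_cplx; apply: omega_infinitesimal;
  first exact: sigmaCM.
exact: sigmaCK.
Qed.

Lemma map_cplx_re_mulmx M z :
  map_mx (@cplx_re R A) (map_mx inj M *m z) = M *m map_mx (@cplx_re R A) z.
Proof.
by apply/matrixP => i j; rewrite mxE !mulmx2E !mxE /cplx_re /= !mul0r !subr0.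
Qed.

Lemma map_cplx_im_mulmx M z :
  map_mx (@cplx_im R A) (map_mx inj M *m z) = M *m map_mx (@cplx_im R A) z.
Proof.
by apply/matrixP => i j; rewrite mxE !mulmx2E !mxE /cplx_im /= !mul0r !addr0.
Qed.

(** A matrix with entries in [A] acts separately on real and imaginary parts, as [complexify]
    does. *)
Lemma complexifyE f z : rlinear f ->
  complexify f z = map_mx inj (rlinear_mx f) *m z.
Proof.
move=> flin; rewrite /complexify ccol_scaleE.
rewrite (rlinear_mxE (map_mx (@cplx_re R A) z) flin) (rlinear_mxE (map_mx
  (@cplx_im R A) z) flin).
rewrite -map_cplx_re_mulmx -map_cplx_im_mulmx; move: (_ *m z) => w;
  apply/matrixP => i j.
rewrite !mxE -scalerAl mul1r; case: (w i j) => u v.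
by congr pair; rewrite /= ?scale0r ?scale1r ?scaler0 ?subr0 ?addr0 ?add0r.
Qed.

(** This is the scalar [j]; the eigenvalue on [eigenline s J] is its opposite [- j]. *)
Definition eigenscalar (s : bool) : R[i] := pm R s * 'i%C.

Lemma eigenscalar_sqr s : eigenscalar s * eigenscalar s = -1.
Proof. by rewrite mulrACA -expr2 sqrr_sign mul1r -expr2 sqr_i. Qed.

Lemma eigenlineE s J z : rlinear J ->
  eigenline s J z <->
  map_mx inj (rlinear_mx J) *m z = - ((eigenscalar s)%:A *: z).
Proof.
by move=> Jlin; rewrite /eigenline /= complexifyE // ccol_scaleE !scaleNr.
Qed.

End Complexification.

(** * Eigenlines *)

Section Eigenlines.
Variables (R : realType) (A : falgType R) (sigma : {linear A -> A}).
Hypotheses (sigma_anti : anti_involution sigma)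
  (A_hermitian : hermitian_pair sigma).
Local Notation AC := (cplx A).
Local Notation inj := (@cplx_inj R A).
Implicit Types (J : 'cV[A]_2 -> 'cV[A]_2) (z w : 'cV[AC]_2) (s : bool).
Local Notation j s := ((eigenscalar R s)%:A : AC).

Lemma eigenscalar_algM s : j s * j s = -1.
Proof. by rewrite -scalerAl mul1r scalerA eigenscalar_sqr scaleN1r. Qed.

Lemma eigenscalar_scaleK s m n (C : 'M[AC]_(m, n)) : j s *: (j s *: C) = - C.
Proof. by rewrite scalerA eigenscalar_algM scaleN1r. Qed.

Lemma oppr_eq_cplx (x : AC) : - x = x -> x = 0.
Proof.
move=> /eqP; rewrite -subr_eq0 -opprD oppr_eq0 -mulr2n -scaler_nat scaler_eq0.
by rewrite pnatr_eq0 => /eqP.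
Qed.

Lemma eigenline_rsubmodule s J : rlinear J -> rsubmodule (eigenline s J).
Proof.
move=> Jlin; split=> [|z w|z a]; rewrite !eigenlineE //.
- by rewrite mulmx0 scaler0 oppr0.
- by move=> zl wl; rewrite mulmxBr zl wl scalerBr opprB opprK addrC.
by move=> zl; rewrite mulmxA zl mulNmx -scalemxAl.
Qed.

Lemma eigenline_scale s J c z : rlinear J ->
  eigenline s J z -> eigenline s J (c%:A *: z).
Proof.
move=> Jlin; rewrite !eigenlineE // => zl.
by rewrite alg_scalemxAr zl scalerN !scale_algA mulrC.
Qed.

(** Moving [J] across the form changes the sign, while both arguments have the same eigenvalue. So
    [j * omega (z, w)] is its own opposite, and [j] is invertible. *)
Lemma eigenline_isotropic s J z w : complex_structures sigma J ->
  eigenline s J z -> eigenline s J w -> omegaC sigma z w = 0.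
Proof.
move=> JC; have [Jlin _ _] := JC.
rewrite !eigenlineE // => zl wl.
have := omegaC_infinitesimal sigma_anti z w (complex_structure_infinitesimal
  sigma_anti JC).
rewrite zl wl /omegaC omegaNl omegaNr -!/(omegaC _ _ _) omegaC_Zl // omegaC_Zr
  //.
move=> /eqP; rewrite opprK => /eqP /oppr_eq_cplx jw0.
apply/eqP; rewrite -oppr_eq0 -mulN1r -(eigenscalar_algM s) -mulrA.
by rewrite /omegaC jw0 mulr0.
Qed.

(** The projection to the eigenspace of [- j] is [(1 + j J) / 2]; this is twice the image of the
    first basis column. *)
Definition eigenvector s J : 'cV[AC]_2 :=
  delta_mx 0 0 + j s *: (map_mx inj (rlinear_mx J) *m delta_mx 0 0).

Lemma complex_structure_sqrC J : complex_structures sigma J ->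
  map_mx inj (rlinear_mx J) *m map_mx inj (rlinear_mx J) = -1%:M.
Proof.
move=> JC; rewrite -map_mxM (complex_structure_sqr JC) map_mxN.
by rewrite map_scalar_mx rmorph1.
Qed.

Lemma eigenvector_eigenline s J : complex_structures sigma J ->
  eigenline s J (eigenvector s J).
Proof.
move=> JC; have [Jlin _ _] := JC; rewrite eigenlineE // /eigenvector.
rewrite mulmxDr alg_scalemxAr mulmxA complex_structure_sqrC // mulNmx mul1mx.
by rewrite scalerDr eigenscalar_scaleK scalerN opprD opprK addrC.
Qed.

Lemma eigenvector_invertible s J : complex_structures sigma J ->
  invertible_elts (map_mx inj (rlinear_mx J) 1 0) /\
  invertible_elts (eigenvector s J 1 0).
Proof.
move=> JC; have [q [sq qV M10]] :=
  complex_structure_invertible sigma_anti A_hermitian JC.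
have PV : invertible_elts (map_mx inj (rlinear_mx J) 1 0).
  have [u [qu uq]] : invertible_elts (- q ^+ 2).
    by rewrite expr2; exact/invertible_eltsN/invertible_eltsM.
  by rewrite mxE M10; exists (inj u); rewrite -!rmorphM qu uq.
split=> //; rewrite /eigenvector -colE; move: (map_mx _ _) PV => P PV.
rewrite !mxE add0r; apply: invertible_eltsM => //.
by exists (- j s); rewrite mulrN mulNr eigenscalar_algM opprK.
Qed.

(** A multiple of the eigenvector cancels the second entry of any [w] in the eigenline. For the
    remainder [d], the second row of [J d = - j d] says that the invertible lower left entry of [J]
    kills [d 0 0]. *)
Lemma eigenline_line s J : complex_structures sigma J ->
  regular (eigenvector s J) /\ eigenline s J = line (eigenvector s J).
Proof.
move=> JC; have [Jlin _ _] := JC.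
have [[v [_ vP]] [u [zu uz]]] := eigenvector_invertible s JC.
have [l0 lB lM] := eigenline_rsubmodule s Jlin.
have zl := eigenvector_eigenline s JC.
split; first by apply: regular_invertible; exists u.
apply/seteqP; split=> [w wl|_ [a _ <-]]; last exact: lM.
pose a := u * w 1 0; exists a => //; apply/eqP; rewrite eq_sym -subr_eq0;
  apply/eqP.
have := lB _ _ wl (lM _ a zl); set d := w - _ => dl.
have d1 : d 1 0 = 0.
  by rewrite /d addcolE mxE mul_col_scalarE /a mulrA zu mul1r subrr.
apply: col2P; rewrite ?d1 [RHS]mxE //.
move: dl; rewrite eigenlineE // => /matrixP/(_ 1 0).
rewrite mulmx2E d1 mulr0 addr0 [RHS]mxE [X in - X]mxE d1 mulr0 oppr0 => Pd.
by rewrite -[LHS]mul1r -vP -mulrA Pd mulr0.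
Qed.

Lemma eigenscalar_algE s : j s = (0, (-1) ^+ s).
Proof.
case: s; rewrite /eigenscalar /pm ?expr1 ?expr0 ?mulN1r ?mul1r; congr pair;
  by rewrite /= ?oppr0 ?scaler0 ?scale0r ?subr0 ?add0r ?scaleN1r ?scale1r.
Qed.

(** Since [P] has entries in [A], conjugation sends [e + j P e] to [e - j P e]. Both [e] and [P e]
    are isotropic, so only the cross terms remain, in total [- 2 j q ^+ 2]; the factor [i] turns
    [- 2 j] into 2 or -2. *)
Lemma hform_eigenvector s J q : complex_structures sigma J ->
  rlinear_mx J 1 0 = - q ^+ 2 ->
  hform sigma (eigenvector s J) (eigenvector s J) = (2%:R * pm R s) *: inj (q ^+
    2).
Proof.
move=> JC M10; have MI := complex_structure_infinitesimal sigma_anti JC.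
have [_ sM10 _] := MI.
set e := delta_mx 0 0 : 'cV[AC]_2; set P := map_mx inj (rlinear_mx J).
have conjE : col_conj (eigenvector s J) = e - j s *: (P *m e).
  apply/matrixP => i k; rewrite ord1 /eigenvector -/P -/e -!colE /e /P.
  move: (rlinear_mx J) => M; rewrite !mxE eigenscalar_algE /cplx_conj.
  by case: (i == 0); congr pair => /=;
    rewrite !(mul0r, mulr0, subr0, sub0r, addr0, add0r, oppr0).
have ee : omegaC sigma e e = 0 by rewrite /omegaC omegaE !mxE /= mulr0 mulr1
  raddf0 subrr.
have Pee : omegaC sigma (P *m e) e = inj (q ^+ 2).
  rewrite -[q ^+ 2]opprK -M10 rmorphN /= -sM10 -sigmaC_inj /omegaC omegaE -colE
    /e /P.
  by move: (rlinear_mx J) => M; rewrite !mxE /= mulr0 mulr1 sub0r.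
have ePe : omegaC sigma e (P *m e) = - inj (q ^+ 2).
  by rewrite -Pee omegaC_infinitesimal // opprK.
have PePe : omegaC sigma (P *m e) (P *m e) = 0.
  rewrite omegaC_infinitesimal // mulmxA complex_structure_sqrC // mulNmx
    mul1mx.
  by rewrite /omegaC omegaNr -/(omegaC _ _ _) ee !oppr0.
rewrite /hform conjE /eigenvector -/P -/e /omegaC.
rewrite !omegaDl !omegaDr !omegaNl -!/(omegaC _ _ _).
rewrite !omegaC_Zl // !omegaC_Zr // ee Pee ePe PePe.
rewrite !mulr0 subr0 add0r mulrN -opprD -mulr2n -scaler_nat -scalerAl mul1r.
rewrite scalerN !scalerA -scaleNr /eigenscalar; congr (_ *: _).
by rewrite (mulrC 'i%C 2%:R) mulrACA -expr2 sqr_i mulrN1 opprK.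
Qed.

Lemma eigenline_projective s :
  set_fun (complex_structures sigma) (projective_model sigma s) (eigenline s).
Proof.
move=> J JC; have [zreg ->] := eigenline_line s JC; exists (eigenvector s J);
  split=> //.
  by apply: (eigenline_isotropic (s := s) JC); exact: eigenvector_eigenline.
have [q [sq [u [qu uq]] M10]] := complex_structure_invertible sigma_anti
  A_hermitian JC.
rewrite (hform_eigenvector s JC M10).
(* The witness [sqrt 2 q] is symmetric and invertible because [q] is. *)
have pos : positive_elts (sigmaC_bar sigma) (2%:R *: inj (q ^+ 2)).
  exists (inj (Num.sqrt 2%:R *: q)).
    split.
      by rewrite /symmetric_elts /= /sigmaC_bar /cplx_inj /= linearZ /= sq
        linear0 oppr0.
    exists (inj ((Num.sqrt 2%:R)^-1 *: u)).
    by rewrite -!rmorphM /= -!scalerAl -!scalerAr !scalerA qu uq mulfV ?mulVf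
      ?scale1r ?sqrtr_eq0 -?ltNge ?ltr0n.
  rewrite -rmorphXn /= exprZn sqr_sqrtr ?ler0n //.
  by rewrite !scaler_nat rmorphMn.
case: s {zreg} => //; rewrite /pm ?expr1 ?expr0 ?mulr1 //.
by exists (2%:R *: inj (q ^+ 2)); rewrite ?mulrN1 ?scaleNr.
Qed.

End Eigenlines.

(** * Velocities of eigenlines *)

Section Velocities.
Variables (R : realType) (A : falgType R) (sigma : {linear A -> A}).
Hypotheses (sigma_anti : anti_involution sigma)
  (A_hermitian : hermitian_pair sigma).
Local Notation AC := (cplx A).
Local Notation inj := (@cplx_inj R A).
Implicit Types (J L : 'cV[A]_2 -> 'cV[A]_2) (g : R -> 'cV[A]_2 -> 'cV[A]_2).
Implicit Types (y z : R -> 'cV[AC]_2) (w : 'cV[AC]_2) (s : bool).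
Local Notation j s := ((eigenscalar R s)%:A : AC).
Local Notation re := (map_mx (@cplx_re R A)).
Local Notation im := (map_mx (@cplx_im R A)).

Lemma derivative0_colE (f : R -> 'cV[A]_2) v :
  derivative0_col f v <-> derivative0_mx f v.
Proof. by split=> fv i => [k|]; rewrite ?ord1; exact: fv. Qed.

Lemma col_re_im_inj (u v : 'cV[AC]_2) : re u = re v -> im u = im v -> u = v.
Proof.
move=> /matrixP reuv /matrixP imuv; apply/matrixP => i k.
have := reuv i k; have := imuv i k; rewrite !mxE /cplx_re /cplx_im.
by case: (u i k) (v i k) => [a b] [c d] /= -> ->.
Qed.

Lemma map_cplx_reD (u v : 'cV[AC]_2) : re (u + v) = re u + re v.
Proof. by apply/matrixP => i k; rewrite !mxE. Qed.

Lemma map_cplx_imD (u v : 'cV[AC]_2) : im (u + v) = im u + im v.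
Proof. by apply/matrixP => i k; rewrite !mxE. Qed.

(** Complex scaling is written with constant scalar matrices over [A], so that [derivative0_mx_mull]
    differentiates it. *)
Lemma map_cplx_reZ (c : R[i]) (u : 'cV[AC]_2) :
  re (c%:A *: u) = ((complex.Re c)%:A)%:M *m re u + ((- complex.Im c)%:A)%:M *m
    im u.
Proof.
apply/matrixP => i k; rewrite !mul_scalar_mx !mxE -scalerAl mul1r.
by rewrite -!scalerAl !mul1r scaleNr.
Qed.

Lemma map_cplx_imZ (c : R[i]) (u : 'cV[AC]_2) :
  im (c%:A *: u) = ((complex.Re c)%:A)%:M *m im u + ((complex.Im c)%:A)%:M *m re
    u.
Proof.
apply/matrixP => i k; rewrite !mul_scalar_mx !mxE -scalerAl mul1r.
by rewrite -!scalerAl !mul1r.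
Qed.

Lemma derivative0_ccolE z w :
  derivative0_ccol z w <->
  derivative0_mx (fun t => re (z t)) (re w) /\
  derivative0_mx (fun t => im (z t)) (im w).
Proof. by rewrite /derivative0_ccol !derivative0_colE. Qed.

Lemma derivative0_ccol_unique z w w' :
  derivative0_ccol z w -> derivative0_ccol z w' -> w = w'.
Proof.
move=> /derivative0_ccolE[rw iw] /derivative0_ccolE[rw' iw'].
apply: col_re_im_inj; first exact: derivative0_mx_unique rw rw'.
exact: derivative0_mx_unique iw iw'.
Qed.

Lemma near_derivative0_ccol y z w : {near (0 : R), y =1 z} ->
  derivative0_ccol y w -> derivative0_ccol z w.
Proof.
move=> yz /derivative0_ccolE[rw iw]; apply/derivative0_ccolE; split.
  by apply: near_derivative0_mx rw; apply: filterS yz => t /= ->.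
by apply: near_derivative0_mx iw; apply: filterS yz => t /= ->.
Qed.

Lemma derivative0_ccol_cst w : derivative0_ccol (fun=> w) 0.
Proof.
apply/derivative0_ccolE; rewrite (_ : re 0 = 0); last by apply/matrixP => i k;
  rewrite !mxE.
rewrite (_ : im 0 = 0); last by apply/matrixP => i k; rewrite !mxE.
by split; exact: derivative0_mx_cst.
Qed.

Lemma derivative0_ccolD y z (v w : 'cV[AC]_2) :
  derivative0_ccol y v -> derivative0_ccol z w ->
  derivative0_ccol (fun t => y t + z t) (v + w).
Proof.
move=> /derivative0_ccolE[rv iv] /derivative0_ccolE[rw iw];
  apply/derivative0_ccolE.
rewrite map_cplx_reD map_cplx_imD.
under [fun t => re _]eq_fun do rewrite map_cplx_reD.
under [fun t => im _]eq_fun do rewrite map_cplx_imD.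
by split; exact: derivative0_mxD.
Qed.

Lemma derivative0_ccolM (M : R -> 'M[A]_2) N z w :
  derivative0_mx M N -> derivative0_ccol z w ->
  derivative0_ccol (fun t => map_mx inj (M t) *m z t)
    (map_mx inj N *m z 0 + map_mx inj (M 0) *m w).
Proof.
move=> MN /derivative0_ccolE[rw iw]; apply/derivative0_ccolE.
rewrite map_cplx_reD map_cplx_imD !map_cplx_re_mulmx !map_cplx_im_mulmx.
under [fun t => re _]eq_fun do rewrite map_cplx_re_mulmx.
under [fun t => im _]eq_fun do rewrite map_cplx_im_mulmx.
by split; exact: derivative0_mxM.
Qed.

Lemma derivative0_mx_mull (C : 'M[A]_2) (f : R -> 'cV[A]_2) v :
  derivative0_mx f v -> derivative0_mx (fun t => C *m f t) (C *m v).
Proof.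
by move=> fv; have := derivative0_mxM (derivative0_mx_cst C) fv;
  rewrite mul0mx add0r.
Qed.

Lemma derivative0_ccolZ (c : R[i]) z w :
  derivative0_ccol z w -> derivative0_ccol (fun t => c%:A *: z t) (c%:A *: w).
Proof.
move=> /derivative0_ccolE[rw iw]; apply/derivative0_ccolE.
rewrite map_cplx_reZ map_cplx_imZ.
under [fun t => re _]eq_fun do rewrite map_cplx_reZ.
under [fun t => im _]eq_fun do rewrite map_cplx_imZ.
by split; apply: derivative0_mxD; exact: derivative0_mx_mull.
Qed.

Lemma curve_through_mx g J L : curve_through sigma g J L ->
  derivative0_mx (fun t => rlinear_mx (g t)) (rlinear_mx L).
Proof.
move=> [_ _ gL] i k; rewrite mxE; under eq_fun do rewrite mxE.
exact: gL.
Qed.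

(** The square of the matrix of [g t] is constantly -1 near 0; the product rule then gives
    [L J + J L = 0]. *)
Lemma tangent_anticommute J L : tangent_complex_structures sigma J L ->
  rlinear_mx L *m rlinear_mx J = - (rlinear_mx J *m rlinear_mx L).
Proof.
move=> [_ [g gJL]]; have [gC g0 _] := gJL; have gM := curve_through_mx gJL.
apply/eqP; rewrite -addr_eq0 -g0; apply/eqP.
apply: derivative0_mx_unique (derivative0_mxM gM gM) _.
apply: near_derivative0_mx (derivative0_mx_cst (-1%:M)).
by apply: filterS gC => t /= /complex_structure_sqr ->.
Qed.

(** The relations between the entries are linear and hold along the curve near 0, so uniqueness of
    derivatives passes them to [L]. *)
Lemma tangent_infinitesimal J L : tangent_complex_structures sigma J L ->
  infinitesimal_symplectic sigma (rlinear_mx L).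
Proof.
move=> [_ [g gJL]]; have [gC g0 _] := gJL; have gM := curve_through_mx gJL.
have gI : \forall t \near (0 : R), infinitesimal_symplectic sigma (rlinear_mx (g
  t)).
  by apply: filterS gC => t; exact: complex_structure_infinitesimal.
split.
- apply: derivative0_unique (gM 1 1) _.
  apply: near_derivative0 (derivative0_linear (\- sigma) (gM 0 0)).
  by apply: filterS gI => t [].
- apply: derivative0_unique (gM 1 0);
  apply: near_derivative0 (derivative0_linear sigma (gM 1 0)).
  by apply: filterS gI => t [].
apply: derivative0_unique (gM 0 1);
  apply: near_derivative0 (derivative0_linear sigma (gM 0 1)).
by apply: filterS gI => t [].
Qed.

Lemma eigenline_lift s g J L : curve_through sigma g J L ->
  exists z w, lifts (fun t => eigenline s (g t)) z w.
Proof.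
move=> gJL; have [gC _ _] := gJL; have gM := curve_through_mx gJL.
(* The eigenvector is affine in the matrix of [g t], hence differentiable; its velocity is left open
   and filled in by the derivative rules. *)
exists (fun t => eigenvector s (g t)); eexists; split.
  by apply: filterS gC => t; exact: eigenline_line.
apply: derivative0_ccolD; first exact: derivative0_ccol_cst.
exact/derivative0_ccolZ/derivative0_ccolM/derivative0_ccol_cst.
Qed.

(** The matrix of [(j / 2) L]. It does not involve a generator of the line, so it serves as the
    common [M] in [bracket_quotient_map]. *)
Definition velocity_mx s L : 'M[AC]_2 :=
  ((pm R s * ('i%C / 2%:R))%:A : AC) *: map_mx inj (rlinear_mx L).

(* Differentiating [g t (z t) = - j *: z t] at [0]. *)
Lemma eigenline_lift_velocity s g J L z w : rlinear L ->
  complex_structures sigma J ->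
  curve_through sigma g J L -> lifts (fun t => eigenline s (g t)) z w ->
  eigenline s J (w - velocity_mx s L *m z 0).
Proof.
move=> Llin JC gJL [zl zw]; have [gC g0 _] := gJL;
  have gM := curve_through_mx gJL.
have [Jlin _ _] := JC.
have zE : \forall t \near (0 : R),
    - (j s *: z t) = map_mx inj (rlinear_mx (g t)) *m z t.
  apply: filterS2 gC zl => t [gt_lin _ _] [_ gt_line];
    apply/esym/eigenlineE => //.
  by rewrite gt_line; exists 1 => //; rewrite mulmx1.
have z0E := nbhs_singleton zE; rewrite g0 in z0E.
have zD : derivative0_ccol (fun t => - (j s *: z t)) (- (j s *: w)).
  have := derivative0_ccolZ (- eigenscalar R s) zw.
  by rewrite !scaleNr; under eq_fun do rewrite !scaleNr.
have {zD} := derivative0_ccol_unique (near_derivative0_ccol zE zD)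
  (derivative0_ccolM gM zw).
rewrite g0 => wE; rewrite eigenlineE // mulmxBr /velocity_mx -scalemxAl
  alg_scalemxAr.
have LJ : tangent_complex_structures sigma J L by split; last by exists g.
have /(congr1 (map_mx inj)) := tangent_anticommute LJ.
rewrite map_mxN !map_mxM => anti.
rewrite mulmxA -[_ *m map_mx _ _]opprK -anti mulNmx -mulmxA -z0E mulmxN opprK.
rewrite alg_scalemxAr.
have -> : map_mx inj (rlinear_mx J) *m w = - (j s *: w) - map_mx inj (rlinear_mx
  L) *m z 0.
  by rewrite wE addrC addKr.
(* With [u = L (z 0)] and [h = u / 2], both sides equal [- j w - h]: on the left, [J w = - j w - u],
   and anticommutation gives [J (j / 2) u = (j / 2) j u = - h]. *)
move: (_ *m z 0) => u; pose h := (2%:R^-1 : R[i])%:A *: u.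
have uh : u = h + h.
  by rewrite /h -scalerDl -scalerDl -[2%:R^-1]mul1r -splitr !scale1r.
have jh : (pm R s * ('i%C / 2%:R))%:A *: (j s *: u) = - h.
  rewrite scale_algA /eigenscalar mulrACA -expr2 sqrr_sign mul1r mulrAC -expr2
    sqr_i.
  by rewrite mulN1r !scaleNr.
have hj : j s *: ((pm R s * ('i%C / 2%:R))%:A *: u) = - h.
  by rewrite scale_algA mulrC -scale_algA.
by rewrite scalerBr jh hj {1}uh !opprD !opprK addrA addrNK.
Qed.

Lemma line_eq_generator s J x : line x = eigenline s J -> eigenline s J x.
Proof. by move=> <-; exists 1 => //; rewrite mulmx1. Qed.

(** The brackets at [x] and at the generator [z 0] of an arbitrary lift both reduce to
    [v |-> velocity_mx s L *m v + l], the second because [w] and [velocity_mx s L *m z 0] agree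
    modulo the eigenline. *)
Lemma eigenline_differential s J L x : complex_structures sigma J ->
    rlinear L -> eigenline s J = line x ->
  differential_at sigma (eigenline s) J L
    (bracket (eigenline s J) x (col_coset (eigenline s J) (velocity_mx s L *m
      x))).
Proof.
move=> JC Llin lx g gJL; have [_ g0 _] := gJL; have [Jlin _ _] := JC.
have lP := eigenline_rsubmodule s Jlin.
split=> [|z w zw]; first exact: eigenline_lift gJL.
rewrite g0 => v; rewrite inE => vl;
  rewrite (bracket_quotient_map (M := velocity_mx s L)) -?lx //.
have [zreg zline] := nbhs_singleton zw.1; rewrite g0 in zline.
rewrite (bracket_quotient_map (M := velocity_mx s L)) -?zline //.
exact: eq_col_coset (eigenline_lift_velocity Llin JC gJL zw).
Qed.

Lemma ccol_scale_complexify s L (v : 'cV[AC]_2) : rlinear L ->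
  ccol_scale (pm R s * ('i%C / 2%:R)) (complexify L v) = velocity_mx s L *m v.
Proof. by move=> Llin; rewrite ccol_scaleE complexifyE // scalemxAl. Qed.

(** The eigenline is stable under complex scalars, so scaling a coset only moves its
    representative. *)
Lemma coset_cscale_quotient_map s J L (c : R[i]) (v : 'cV[AC]_2) : rlinear J ->
  coset_cscale (eigenline s J) c (quotient_map (eigenline s J) (complexify L) v)
    =
  col_coset (eigenline s J) (ccol_scale c (complexify L v)).
Proof.
move=> Jlin; have lP := eigenline_rsubmodule s Jlin; have [l0 _ _] := lP.
apply/seteqP; split=> [_ [_ [u ul <-]] [u' ul' <-]|_ [u ul <-]].
  exists (c%:A *: u + u'); first by apply: rsubmoduleD => //;
    exact: eigenline_scale.
  by rewrite !ccol_scaleE [in RHS]scalerDr addrA.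
by exists (complexify L v); [exists 0; rewrite ?addr0 | exists u].
Qed.

Lemma eigenline_tangent s J L x : complex_structures sigma J ->
    tangent_complex_structures sigma J L -> eigenline s J = line x ->
  tangent_projective_model sigma s (eigenline s J)
    (bracket (eigenline s J) x (col_coset (eigenline s J) (velocity_mx s L *m
      x))).
Proof.
move=> JC LT lx; have [Jlin _ _] := JC; have lP := eigenline_rsubmodule s Jlin.
have QE v : eigenline s J v -> bracket (eigenline s J) x
    (col_coset (eigenline s J) (velocity_mx s L *m x)) v =
    quotient_map (eigenline s J) (mulmx (velocity_mx s L)) v.
  by move=> vl; rewrite (bracket_quotient_map (M := velocity_mx s L)) -?lx.
have [lQ DQ MQ] := quotient_map_hom (velocity_mx s L) lP.
have [_ _ lM] := lP.
split; first exact: eigenline_projective.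
  split=> [v vl|v v' vl vl'|v a vl].
  - by rewrite QE //; exact: lQ.
  - by rewrite !QE ?DQ //; exact: rsubmoduleD.
  by rewrite !QE ?MQ //; exact: lM.
move=> y w ly; have yl := line_eq_generator (esym ly).
(* Isotropy of the line removes the contribution of [u]. What is left is a complex multiple of
   [omega (L y, y)], which is symmetric: it equals [- omega (y, L y)], and [sigmaC] exchanges these
   two expressions. *)
rewrite QE // => -[u ul <-]; rewrite /symmetric_elts /=.
rewrite /omegaC omegaDl -!/(omegaC _ _ _) (eigenline_isotropic sigma_anti JC ul
  yl) addr0.
rewrite /velocity_mx -scalemxAl omegaC_Zl // -!scalerAl !mul1r sigmaCZ;
  congr (_ *: _).
have LI := tangent_infinitesimal LT.
rewrite [in RHS]omegaC_infinitesimal // /omegaC !omegaE /=.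
rewrite raddfB /= !sigmaCM // !sigmaCK //.
by rewrite opprB.
Qed.

End Velocities.

Theorem proposition6p17 (R : realType) (A : falgType R)
    (sigma : {linear A -> A})
    (A_semisimple : semisimple A)
    (sigma_anti : anti_involution sigma)
    (A_hermitian : hermitian_pair sigma)
    (s : bool) :
  set_fun (complex_structures sigma) (projective_model sigma s)
    (eigenline s) /\
  forall J L : 'cV[A]_2 -> 'cV[A]_2,
  complex_structures sigma J ->
  tangent_complex_structures sigma J L ->
  forall x : 'cV[cplx A]_2,
  let l := eigenline s J in
  let c : R[i] := pm R s * ('i%C / 2%:R) in
  let Q := bracket l x (col_coset l (ccol_scale c (complexify L x))) in
  l = line x ->
  [/\ differential_at sigma (eigenline s) J L Q,
      {in l, Q =1 fun v => coset_cscale l c (quotient_map l (complexify L) v)} &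
      tangent_projective_model sigma s l Q].
Proof.
split=> [|J L JC LT x l c Q lx]; first exact: eigenline_projective.
have [Llin _] := LT; have [Jlin _ _] := JC.
have QE : Q = bracket l x (col_coset l (velocity_mx s L *m x)).
  by rewrite /Q /c ccol_scale_complexify.
split; rewrite ?QE; [exact: eigenline_differential| |exact: eigenline_tangent].
move=> v; rewrite inE => vl; rewrite coset_cscale_quotient_map //.
(* On the line, the bracket and the scaled quotient map both become
   [v |-> velocity_mx s L *m v + l]. *)
rewrite (bracket_quotient_map (M := velocity_mx s L)) -?lx //;
  first by rewrite /quotient_map ccol_scale_complexify.
exact: eigenline_rsubmodule.
Qed.
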